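(* Let $f:[0,1]\to\mathbb{R}$ be a continuous function. Then there exists a real number $a$ such that the integral $$\int_0^1 \frac{1}{|f(x)-a|}\,dx$$ diverges.
   Context: The integrand $\frac{1}{|f(x)-a|}$ is regarded as a nonnegative extended-real-valued function on $[0,1]$, with the value $+\infty$ at points $x$ where $f(x)=a$. ''Diverges'' means that the integral (as the Lebesgue integral of a nonnegative extended-real-valued measurable function, equivalently the limit as $C\to\infty$ of the integrals of the truncations $\min\left(C,|f(x)-a|^{-1}\right)$) equals $+\infty$. *)

(* Defs.v *)
From mathcomp Require Export all_boot all_order all_algebra.
From mathcomp Require Export all_classical all_reals all_analysis.
Export numFieldNormedType.Exports.

Set Implicit Arguments.
Unset Strict Implicit.
Unset Printing Implicit Defensive.

(* Main.v *)
Require Import Defs.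
From mathcomp Require Import all_boot all_order all_algebra.
From mathcomp Require Import all_classical all_reals all_analysis.
From mathcomp Require Import measurable_realfun ring lra.
Import Order.TTheory GRing.Theory Num.Theory.
Import numFieldNormedType.Exports.

(** The reason lies in the distribution of the values of [f] rather than in
    continuity: no measure of positive mass on a bounded interval can have a
    finite potential [a |-> \int dnu(y) / |y - a|] at every point.  Here [nu]
    is the image of Lebesgue measure under [f]; the compactness of [0,1] is
    what bounds its support.

    Bisect an interval of width [w] carrying mass at least [m], keeping each
    time a half that carries at least half of the mass.  The intervals obtained
    shrink to a point [a], and the [n]-th one, of width [w / 2^n], lies within
    [w / 2^n] of [a], so that [nu] gives mass at least [m / 2^n] to that
    neighbourhood of [a], for every [n] ([exists_concentration]).

    On the points at distance at most [w / 2^n] from [a] the function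
    [1 / |y - a|] is at least [2^n / w], so each dyadic scale should contribute
    about [m / w] to the integral.  These contributions overlap, but the
    overlap is geometric: stacking the weights [2^k] over all the scales which
    see a given point costs only a factor two ([dyadic_weight_le]).  With [N]
    scales the integral is therefore at least [N * m / (2 * w)], for every [N]
    ([integral_inve_dist_eqy]). *)

Local Open Scope classical_set_scope.
Local Open Scope ring_scope.

(** The zeros of [f - a], where the extended inverse is infinite, are split
    off; elsewhere it is the real power of exponent -1. *)
Lemma measurable_fun_inve_dist d (T : measurableType d) (R : realType)
    (D : set T) (f : T -> R) (a : R) :
  measurable_fun D f ->
  measurable_fun D (fun x => (`|f x - a|%:E^-1)%E : \bar R).
Proof.
move=> mf.
have mg : measurable_fun D (fun x => `|f x - a|).
  by apply: measurableT_comp => //; exact: measurable_funB.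
rewrite (_ : (fun x => _) = fun x =>
    if `|f x - a| == 0 then +oo%E else (`|f x - a| `^ (-1))%:E); last first.
  by apply/funext => x; rewrite inver powR_inv1.
move=> mD; move: (mD); apply: measurable_fun_if => //.
  exact: measurable_fun_eqr.
apply: (@measurable_funS _ _ _ _ D) => //.
apply/measurable_EFinP.
by apply: (measurableT_comp (measurable_powR (-1))).
Qed.

Lemma measurable_dist_le d (T : measurableType d) (R : realType)
    (D : set T) (f : T -> R) (a r : R) :
  measurable D -> measurable_fun D f ->
  measurable (D `&` [set x | `|f x - a| <= r]).
Proof.
move=> mD mf.
have mg : measurable_fun D (fun x => `|f x - a|).
  by apply: measurableT_comp => //; exact: measurable_funB.
have := measurable_fun_ler mg (measurable_cst r).
by move=> /(_ mD [set true]); rewrite preimage_true; apply.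
Qed.

(** The weights [2^k] form a geometric progression, so their sum over the
    scales [k] at which [t <= w / 2^k] is at most twice the largest of them,
    itself at most [w / t].  Multiplying by [t] instead of dividing makes the
    case [t = 0] uniform with the others. *)
Lemma dyadic_weight_le (R : realType) (w t : R) (N : nat) :
  0 <= w -> 0 <= t ->
  (\sum_(k < N) 2 ^+ k * (t <= w / 2 ^+ k)%R%:R) * t <= 2 * w.
Proof.
move=> w0 t0; elim: N => [|N IHN]; first by rewrite big_ord0 mul0r mulr_ge0.
have S2 M : \sum_(k < M) 2 ^+ k * (t <= w / 2 ^+ k)%R%:R <= 2 ^+ M :> R.
  elim: M => [|M IHM]; first by rewrite big_ord0 expr0.
  rewrite big_ord_recr /= exprS mulrDl !mul1r lerD//.
  by rewrite -[leRHS]mulr1 ler_wpM2l ?exprn_ge0// lern1 leq_b1.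
have [tN|/negbTE tN] := boolP (t <= w / 2 ^+ N); last first.
  by rewrite big_ord_recr /= tN mulr0 addr0.
(* When the finest scale sees t, all the scales may be counted. *)
apply: (le_trans (ler_pM _ t0 (S2 N.+1) tN)).
  by apply: sumr_ge0 => k _; rewrite mulr_ge0 ?exprn_ge0.
by rewrite exprS -mulrA [_ ^+ N * _]mulrC divfK// expf_neq0.
Qed.

(** Compares the integrand, up to the factor [2 * w], with the sum over [k < N]
    of [2^k] times the indicator of the points at distance at most [w / 2^k].
    Each term has integral at least [m], and [N] is arbitrary. *)
Lemma integral_inve_dist_eqy d (T : measurableType d) (R : realType)
    (mu : {measure set T -> \bar R}) (D : set T) (f : T -> R) (a w m : R) :
  measurable D -> measurable_fun D f -> 0 < w -> 0 < m ->
  (forall n, ((m / 2 ^+ n)%:E <=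
     mu (D `&` [set x | `|f x - a| <= w / 2 ^+ n]%R))%E) ->
  (\int[mu]_(x in D) `|f x - a|%:E^-1 = +oo)%E.
Proof.
move=> mD mf w0 m0 concentr.
set A := fun n => D `&` [set x | `|f x - a| <= w / 2 ^+ n].
have mA n : measurable (A n) by exact: measurable_dist_le.
pose h (k : nat) x := ((2 ^+ k)%:E * (\1_(A k) x)%:E)%E : \bar R.
have h0 k x : (0 <= h k x)%E by rewrite mule_ge0 ?lee_fin ?exprn_ge0.
have mh k : measurable_fun D (h k).
  apply: emeasurable_funM => //.
  by apply/measurable_EFinP; exact: measurable_indic.
have Ih k : (m%:E <= \int[mu]_(x in D) h k x)%E.
  rewrite /h ge0_integralZl ?lee_fin ?exprn_ge0//; last 1 first.
  - by apply/measurable_EFinP; exact: measurable_indic.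
  rewrite integral_indic// setIidl; last by move=> x [].
  rewrite [in leLHS](_ : m = 2 ^+ k * (m / 2 ^+ k)); last first.
    by rewrite mulrC divfK// expf_neq0.
  by rewrite EFinM lee_pmul2l ?fin_numE ?lte_fin ?exprn_gt0//; exact: concentr.
have main N : (((N%:R * m) / (2 * w))%:E <=
    \int[mu]_(x in D) `|f x - a|%:E^-1)%E.
  rewrite mulrC EFinM.
  have : ((\int[mu]_(x in D) (\sum_(k < N) h k x)) <=
     \int[mu]_(x in D) ((2 * w)%:E * `|f x - a|%:E^-1))%E.
    apply: ge0_le_integral => //.
    - by move=> x _; exact: sume_ge0.
    - by apply: emeasurable_sum.
    - by apply: emeasurable_funM => //; exact: measurable_fun_inve_dist.
    move=> x Dx.
    rewrite inver; case: ifPn => [_|fxa].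
      by rewrite gt0_muley ?leey// lte_fin mulr_gt0.
    rewrite -EFinM sumEFin lee_fin ler_pdivlMr ?lt_neqAle 1?eq_sym ?fxa//=.
    apply: le_trans (dyadic_weight_le _ _ _ N (ltW w0) (normr_ge0 (f x - a))).
    rewrite ler_wpM2r// ler_sum// => k _; rewrite ler_wpM2l ?exprn_ge0//.
    by rewrite indicE; case: (boolP (x \in A k)) => //; rewrite inE => -[_ /= ->].
  rewrite ge0_integral_sum// ge0_integralZl//; last 3 first.
  - exact: measurable_fun_inve_dist.
  - by move=> x _; rewrite inve_ge0 lee_fin.
  - by rewrite lee_fin mulr_ge0 // ltW.
  move=> le1.
  have le2 : ((N%:R * m)%:E <= \sum_(k < N) \int[mu]_(x in D) h k x)%E.
    rewrite mulr_natl -[N in leLHS]card_ord -sumr_const -sumEFin.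
    by apply: lee_sum => k _.
  rewrite muleC lee_pdivrMr ?mulr_gt0//.
  by rewrite muleC (le_trans le2).
apply/eqyP => r r0.
apply: le_trans (main (Num.bound (r * (2 * w) / m))).
have w20 : 0 < 2 * w by rewrite mulr_gt0.
have /ltW := archi_boundP (ltW (divr_gt0 (mulr_gt0 r0 w20) m0)).
by rewrite ler_pdivrMr// lee_fin ler_pdivlMr.
Qed.

(** Bisection on the range of [f].  At each step one of the two halves has at
    least half of the mass, by subadditivity; [a] is the common point of the
    nested intervals, reached as the supremum of their left endpoints. *)
Lemma exists_concentration d (T : measurableType d) (R : realType)
    (mu : {measure set T -> \bar R}) (D : set T) (f : T -> R) (l w m : R) :
  measurable D -> measurable_fun D f -> 0 <= w -> (m%:E <= mu D)%E ->
  (forall x, D x -> l <= f x <= l + w) ->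
  exists a, forall n, ((m / 2 ^+ n)%:E <=
     mu (D `&` [set x | `|f x - a| <= w / 2 ^+ n]%R))%E.
Proof.
move=> mD mf w0 mDm Df.
pose F (u v : R) := D `&` [set x | u <= f x <= v].
have mF u v : measurable (F u v).
  have := mf mD _ (measurable_itv `[u, v]).
  by rewrite set_itvE.
(* [L n] is the left endpoint of the n-th interval, whose width is w / 2^n; the
   left half is kept whenever it is heavy enough. *)
pose step n u : R := let h := w / 2 ^+ n.+1 in
  if ((m / 2 ^+ n.+1)%:E <= mu (F u (u + h)%R))%E then u else u + h.
pose L := fix L n := if n is k.+1 then step k (L k) else l.
have halfE (x : R) n : x / 2 ^+ n = x / 2 ^+ n.+1 + x / 2 ^+ n.+1.
  by rewrite exprS invfM; field; rewrite expf_neq0.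
have LF n : ((m / 2 ^+ n)%:E <= mu (F (L n) (L n + w / 2 ^+ n)%R))%E.
  elim: n => [|n IHn].
    rewrite expr0 !divr1 /= (_ : F _ _ = D)//.
    by apply/seteqP; split => [x []//|x Dx]; split => //=; exact: Df.
  rewrite /= /step; case: ifPn => // /negbTE.
  set u := L n; set h := w / 2 ^+ n.+1 => lo.
  (* If both halves were light, the whole interval would be light. *)
  rewrite leNgt; apply/negP => hi; move: IHn; apply/negP; rewrite -ltNge.
  have sub : F u (u + w / 2 ^+ n) `<=` F u (u + h) `|` F (u + h) (u + h + h).
    move=> x [Dx /= /andP[ux xu]].
    have [xh|hx] := leP (f x) (u + h); [left|right]; split => //=.
      by rewrite ux.
    by rewrite (ltW hx)/= -addrA -halfE.
  apply: (le_lt_trans (le_measure mu _ _ sub)); rewrite ?inE//.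
    exact: measurableU.
  apply: (le_lt_trans (measureU2 _ _ _)) => //.
  rewrite (halfE m) EFinD lteD// ltNge; exact/negbT.
have Lincr : nondecreasing_seq L.
  apply/nondecreasing_seqP => n /=; rewrite /step; case: ifP => // _.
  by rewrite lerDl divr_ge0// exprn_ge0.
have Rdecr : nonincreasing_seq (fun n => L n + w / 2 ^+ n).
  apply/nonincreasing_seqP => n /=; rewrite (halfE w n) addrA /step.
  case: ifP => // _; rewrite ?lerD2r// lerDl divr_ge0// exprn_ge0.
have LR k n : L k <= L n + w / 2 ^+ n.
  apply: (le_trans (Lincr _ _ (leq_maxl k n))).
  apply: le_trans (Rdecr _ _ (leq_maxr k n)).
  by rewrite lerDl divr_ge0// exprn_ge0.
exists (sup (range L)) => n; apply: (le_trans (LF n)).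
have La : L n <= sup (range L).
  apply: ub_le_sup; last by exists n.
  by exists (L 0%N + w / 2 ^+ 0) => _ [k _ <-].
have aR : sup (range L) <= L n + w / 2 ^+ n.
  by apply: ge_sup => [|_ [k _ <-]//]; exists (L n), n.
apply: le_measure; rewrite ?inE//; first exact: measurable_dist_le.
move=> x [Dx /= /andP[Lf fR]]; split => //=.
rewrite ler_norml; lra.
Qed.

Theorem theorem7p1 (R : realType) (f : R -> R)
    (cf : {within `[0, 1], continuous f}) :
  exists a : R,
    (\int[lebesgue_measure]_(x in `[0%R, 1%R])
       (1 / `|f x - a|%:E) = +oo)%E.
Proof.
have mf : measurable_fun (`[0, 1] : set R) f.
  exact: subspace_continuous_measurable_fun.
have [p _ fp] := EVT_min (@ler01 R) cf.
have [q _ fq] := EVT_max (@ler01 R) cf.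
have fpq : f p <= f q.
  by apply: (le_trans (fp 0 _)); rewrite ?fq// in_itv/= lexx ler01.
(* The 1 keeps the width positive when f is constant. *)
pose w := f q - f p + 1.
have w0 : 0 < w by rewrite ltr_wpDl// subr_ge0.
have m01 : measurable (`[0, 1] : set R) by exact: measurable_itv.
have mu01 : ((1 : R)%:E <= lebesgue_measure (`[0%R, 1%R] : set R))%E.
  by rewrite lebesgue_measure_itv/= lte_fin ltr01 sube0.
have frange x : `[0, 1]%classic x -> f p <= f x <= f p + w.
  by move=> x01; rewrite fp//= /w addrA subrKC (le_trans (fq _ x01))// lerDl.
have [a ha] := exists_concentration _ _ _ lebesgue_measure _ _ _ _ _
  m01 mf (ltW w0) mu01 frange.
exists a; under eq_integral do rewrite div1e.
exact: (integral_inve_dist_eqy _ _ _ lebesgue_measure _ _ _ _ _ m01 mf w0 ltr01 ha).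
Qed.
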